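(* Let $A$ and $B$ be monoids, let $\phi : B \to \mathrm{End}(A)$ be a homomorphism of monoids, and let $M = A\phi B$ be the corresponding semi-direct product. The assignment $\chi \longmapsto \mathrm{Ker}(\overline{\chi})$ on objects, where the map $\overline{\chi} : A\phi B \to A$ is defined by $\overline{\chi}(ab) = a\chi(b)^{-1}$, yields an isomorphism of groupoids $$\mathcal{Z}^1(B,U(A))/\!/U(A) \simeq \mathsf{FAC}(A/A\phi B)/\!/U(A),$$ which in turn induces an isomorphism of pointed sets $$\mathbf{H}^1(B,U(A)) \simeq \pi_0\big(\mathsf{FAC}(A/A\phi B)/\!/U(A)\big),$$ where $\pi_0(\mathsf{FAC}(A/A\phi B)/\!/U(A))$ is the set of isomorphism classes of objects of the groupoid $\mathsf{FAC}(A/A\phi B)/\!/U(A)$.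
   Context: $\mathrm{End}(A)$ is the monoid of monoid endomorphisms of $A$ under composition. A homomorphism $\phi : B \to \mathrm{End}(A)$ is the same as a left action of the monoid $B$ on the monoid $A$, written $b \star a = \phi(b)(a)$; it restricts to a left action of $B$ on the group $U(A)$ of invertible elements of $A$. The semi-direct product $A\phi B$ is the set of formal products $ab$ with $a \in A$, $b \in B$ (i.e. $A\times B$ as a set), with identity $1_A 1_B$ and multiplication $(a_1 b_1)\bullet(a_2 b_2) = \big(a_1 (b_1 \star a_2)\big)(b_1 b_2)$. $A$ and $B$ are identified with the submonoids $\{a 1_B\}$ and $\{1_A b\}$ of $A\phi B$. $\mathcal{Z}^1(B,U(A))$ is the set of 1-cocycles: maps $\chi : B \to U(A)$ with $\chi(1_B) = 1_A$ and $\chi(b_1 b_2) = \chi(b_1)(b_1 \star \chi(b_2))$, pointed by the constant map $1_A$. Two 1-cocycles $\chi,\chi'$ are cohomologous if there is $a_0 \in U(A)$ with $\chi(b)(b \star a_0) = a_0 \chi'(b)$ for all $b \in B$; this is an equivalence relation and $\mathbf{H}^1(B,U(A))$ is the pointed set of equivalence classes. The group $U(A)$ acts on $\mathcal{Z}^1(B,U(A))$ from the left by $(a\cdot\chi)(b) = a\,\chi(b)\,(b \star a)^{-1}$, so that $\mathbf{H}^1(B,U(A))$ is the set of orbits. A pair $(A,C)$ of submonoids of a monoid $M$ is a factorization of $M$ if the multiplication map $A \times C \to M$ is bijective; $\mathsf{FAC}(A/M)$ is the set of submonoids $C$ of $M$ such that $(A,C)$ is a factorization of $M$. $U(A)$ acts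 on $\mathsf{FAC}(A/M)$ from the left by conjugation, $C \mapsto aCa^{-1}$. $\mathsf{FAC}(A/A\phi B)$ is pointed by $B$, and $\pi_0$ by the class of $B$. For a map $f: A\phi B\to A$, $\mathrm{Ker}(f)$ is the set of elements mapped to $1_A$. For a left action of a group $G$ on a set $X$, the action groupoid $X/\!/G$ has $X$ as set of objects, and a morphism from $x$ to $x'$ is an element $g\in G$ with $gx = x'$. *)

(* Defs.v *)
From HB Require Import structures.
From mathcomp Require Import all_boot.
From mathcomp Require Import boolp classical_sets functions.

Set Implicit Arguments.
Unset Strict Implicit.
Unset Printing Implicit Defensive.

Local Open Scope classical_set_scope.
Local Open Scope group_scope.
Local Open Scope quotient_scope.

Definition End (A : monoidType) : Type := UMagmaMorphism.type A A.

Section EndMonoid.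
Variable A : monoidType.
Implicit Types f g h : End A.

Lemma end_eq f g : f =1 g -> f = g.
Proof.
case: f g => [f [[fM] [f1]]] [g [[gM] [g1]]] /= fg.
have {fg}/= fg : f = g by apply: funext.
case: _ / fg in gM g1 *.
by rewrite (Prop_irrelevance fM gM) (Prop_irrelevance f1 g1).
Qed.

HB.instance Definition _ := gen_eqMixin (End A).
HB.instance Definition _ := gen_choiceMixin (End A).

Definition end_one : End A := UMagmaMorphism.clone A A idfun _.
Definition end_mul f g : End A :=
  UMagmaMorphism.clone A A (f \o g) _.

Lemma end_mulA : associative end_mul.
Proof. by move=> f g h; apply: end_eq. Qed.
Lemma end_mul1 : left_id end_one end_mul.
Proof. by move=> f; apply: end_eq. Qed.
Lemma end_mulr1 : right_id end_one end_mul.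
Proof. by move=> f; apply: end_eq. Qed.

HB.instance Definition _ := isMonoid.Build (End A) end_mulA end_mul1 end_mulr1.

Lemma endM f x y : f (x * y) = f x * f y.
Proof. by rewrite gmulfM. Qed.
Lemma end1 f : f 1 = 1.
Proof. by rewrite gmulf1. Qed.
End EndMonoid.

(* An invertible element is stored together with its inverse; since the inverse
   is unique, [uval] is injective (lemma [uval_inj]). *)
Record units (A : monoidType) := Units {
  upair : A * A;
  upairP : (upair.1 * upair.2 == 1) && (upair.2 * upair.1 == 1)
}.
HB.instance Definition _ (A : monoidType) := [isSub for @upair A].
HB.instance Definition _ (A : monoidType) := [Choice of units A by <:].

Section UnitGroup.
Variable A : monoidType.
Implicit Types u v : units A.

Definition uval u : A := (upair u).1.
Definition uinv u : A := (upair u).2.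

Lemma uvalV u : uval u * uinv u = 1.
Proof. by have /andP[/eqP] := upairP u. Qed.
Lemma uinvK u : uinv u * uval u = 1.
Proof. by have /andP[_ /eqP] := upairP u. Qed.

Lemma uval_inj : injective uval.
Proof.
move=> u v uv; apply: val_inj => /=.
suff uvi : uinv u = uinv v.
  by move: uv uvi; rewrite /uval /uinv; case: (upair u) (upair v)
    => [? ?] [? ?] /= -> ->.
by rewrite -[uinv u]mulg1 -(uvalV v) -uv mulgA uinvK mul1g.
Qed.

Lemma mkunit_proof (a b : A) : a * b = 1 -> b * a = 1 ->
  ((a, b).1 * (a, b).2 == 1) && ((a, b).2 * (a, b).1 == 1).
Proof. by move=> /= -> ->; rewrite eqxx. Qed.
Definition mkunit (a b : A) (ab : a * b = 1) (ba : b * a = 1) : units A :=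
  Units (mkunit_proof ab ba).

Lemma units_mulP u v :
  (uval u * uval v) * (uinv v * uinv u) = 1 /\
  (uinv v * uinv u) * (uval u * uval v) = 1.
Proof.
split; first by rewrite mulgA -(mulgA (uval u)) uvalV mulg1 uvalV.
by rewrite mulgA -(mulgA (uinv v)) uinvK mulg1 uinvK.
Qed.

Definition units_one : units A := mkunit (mulg1 1) (mulg1 1).
Definition units_mul u v : units A :=
  mkunit (units_mulP u v).1 (units_mulP u v).2.
Definition units_inv u : units A := mkunit (uinvK u) (uvalV u).

Lemma units_mulA : associative units_mul.
Proof. by move=> u v w; apply: uval_inj; apply: mulgA. Qed.
Lemma units_mul1 : left_id units_one units_mul.
Proof. by move=> u; apply: uval_inj; apply: mul1g. Qed.
Lemma units_mulr1 : right_id units_one units_mul.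
Proof. by move=> u; apply: uval_inj; apply: mulg1. Qed.
Lemma units_mulV : left_inverse units_one units_inv units_mul.
Proof. by move=> u; apply: uval_inj; apply: uinvK. Qed.
Lemma units_mulrV : right_inverse units_one units_inv units_mul.
Proof. by move=> u; apply: uval_inj; apply: uvalV. Qed.

HB.instance Definition _ := isGroup.Build (units A)
  units_mulA units_mul1 units_mulr1 units_mulV units_mulrV.

Lemma uval1 : uval 1 = 1. Proof. by []. Qed.
Lemma uvalM u v : uval (u * v) = uval u * uval v. Proof. by []. Qed.
Lemma uval_inv u : uval u^-1 = uinv u. Proof. by []. Qed.
End UnitGroup.

Record gaction (G : groupType) (X : Type) := GAction {
  gact :> G -> X -> X;
  gact1 : forall x, gact 1 x = x;
  gactM : forall g h x, gact (g * h) x = gact g (gact h x)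
}.

Record groupoid := Groupoid {
  ob :> choiceType;
  hom : ob -> ob -> Type;
  idm : forall x, hom x x;
  comp : forall x y z, hom y z -> hom x y -> hom x z;
  invm : forall x y, hom x y -> hom y x;
  compA : forall x y z t (f : hom z t) (g : hom y z) (h : hom x y),
    comp f (comp g h) = comp (comp f g) h;
  comp1m : forall x y (f : hom x y), comp (idm y) f = f;
  compm1 : forall x y (f : hom x y), comp f (idm x) = f;
  compVm : forall x y (f : hom x y), comp (invm f) f = idm x;
  compmV : forall x y (f : hom x y), comp f (invm f) = idm y
}.
Arguments idm {g0} x.

Record functor (G H : groupoid) := Functor {
  fob :> G -> H;
  fhom : forall x y, hom x y -> hom (fob x) (fob y);
  fhom1 : forall x, fhom (idm x) = idm (fob x);
  fhomM : forall x y z (f : hom y z) (g : hom x y),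
    fhom (comp f g) = comp (fhom f) (fhom g)
}.

Definition functor_id (G : groupoid) : functor G G :=
  @Functor G G id (fun x y f => f) (fun x => erefl) (fun x y z f g => erefl).

Section FunctorComp.
Variables (G H K : groupoid) (E : functor H K) (F : functor G H).
Lemma functor_comp1 x : fhom E (fhom F (idm x)) = idm (E (F x)).
Proof. by rewrite !fhom1. Qed.
Lemma functor_compM x y z (f : hom y z) (g : @hom G x y) :
  fhom E (fhom F (comp f g)) = comp (fhom E (fhom F f)) (fhom E (fhom F g)).
Proof. by rewrite !fhomM. Qed.
Definition functor_comp : functor G K :=
  @Functor G K (fun x => E (F x)) (fun x y f => fhom E (fhom F f))
    functor_comp1 functor_compM.
End FunctorComp.

Definition groupoid_iso (G H : groupoid) (F : functor G H) : Prop :=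
  exists E : functor H G,
    functor_comp E F = functor_id G /\ functor_comp F E = functor_id H.

Section Pi0.
Variable G : groupoid.
Definition isomorphic : rel G := fun x y => `[< inhabited (hom x y) >].

Lemma isomorphic_refl : reflexive isomorphic.
Proof. by move=> x; apply/asboolP; exists; apply: idm. Qed.
Lemma isomorphic_sym : symmetric isomorphic.
Proof.
by move=> x y; apply/asboolP/asboolP => -[f]; exists; apply: invm.
Qed.
Lemma isomorphic_trans : transitive isomorphic.
Proof.
move=> y x z /asboolP[f] /asboolP[g]; apply/asboolP.
by exists; apply: comp g f.
Qed.
Canonical isomorphic_equiv :=
  EquivRel isomorphic isomorphic_refl isomorphic_sym isomorphic_trans.

Definition pi0 := {eq_quot isomorphic}.
HB.instance Definition _ := Choice.on pi0.
HB.instance Definition _ := EqQuotient.on pi0.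
End Pi0.

Section ActionGroupoid.
Variables (G : groupType) (X : choiceType) (a : gaction G X).

Definition ahom (x y : X) : Type := {g : G | a g x == y}.

Lemma ahom1_proof x : a 1 x == x.
Proof. by rewrite gact1. Qed.
Lemma ahomM_proof x y z (f : ahom y z) (g : ahom x y) :
  a (sval f * sval g) x == z.
Proof. by rewrite gactM (eqP (svalP g)) (eqP (svalP f)). Qed.
Lemma ahomV_proof x y (f : ahom x y) : a (sval f)^-1 y == x.
Proof. by case: f => g /= /eqP <-; rewrite -gactM mulVg gact1. Qed.

Definition ahom1 x : ahom x x := exist _ 1 (ahom1_proof x).
Definition ahomM x y z (f : ahom y z) (g : ahom x y) : ahom x z :=
  exist _ (sval f * sval g) (ahomM_proof f g).
Definition ahomV x y (f : ahom x y) : ahom y x :=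
  exist _ (sval f)^-1 (ahomV_proof f).

Lemma ahomA x y z t (f : ahom z t) (g : ahom y z) (h : ahom x y) :
  ahomM f (ahomM g h) = ahomM (ahomM f g) h.
Proof. by apply: val_inj; apply: mulgA. Qed.
Lemma ahom1m x y (f : ahom x y) : ahomM (ahom1 y) f = f.
Proof. by apply: val_inj; apply: mul1g. Qed.
Lemma ahomm1 x y (f : ahom x y) : ahomM f (ahom1 x) = f.
Proof. by apply: val_inj; apply: mulg1. Qed.
Lemma ahomVm x y (f : ahom x y) : ahomM (ahomV f) f = ahom1 x.
Proof. by apply: val_inj; apply: mulVg. Qed.
Lemma ahommV x y (f : ahom x y) : ahomM f (ahomV f) = ahom1 y.
Proof. by apply: val_inj; apply: mulgV. Qed.

Definition action_groupoid : groupoid :=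
  @Groupoid X ahom ahom1 ahomM ahomV ahomA ahom1m ahomm1 ahomVm ahommV.

Definition ahom_elt (x y : action_groupoid) (f : hom x y) : G :=
  sval (f : ahom x y).
End ActionGroupoid.

Definition pointed_iso (X Y : pointedType) (f : X -> Y) : Prop :=
  bijective f /\ f point = point.

Section Factorization.
Variable M : monoidType.

Definition submonoid (C : set M) : Prop :=
  C 1 /\ forall x y, C x -> C y -> C (x * y).

Definition factorization (A C : set M) : Prop :=
  [/\ submonoid A, submonoid C &
      set_bij (A `*` C) [set: M] (fun p => p.1 * p.2)].

Definition FAC (A : set M) : set (set M) := [set C | factorization A C].
End Factorization.

(* [U(A)] acts on [FAC(A/M)] when [A] is a submonoid of [M] given by an injective
   morphism [i : A -> M].  Injectivity is not needed to define the action. *)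
Section FACAction.
Variables (A M : monoidType) (i : UMagmaMorphism.type A M).

Definition conj_set (u : units A) (C : set M) : set M :=
  [set i (uval u) * c * i (uinv u) | c in C].

Lemma mor_uvalV (u : units A) : i (uval u) * i (uinv u) = 1.
Proof. by rewrite -gmulfM uvalV gmulf1. Qed.
Lemma mor_uinvK (u : units A) : i (uinv u) * i (uval u) = 1.
Proof. by rewrite -gmulfM uinvK gmulf1. Qed.

Lemma conj_mulIr (u : units A) (x y : M) :
  x * i (uinv u) = y * i (uinv u) -> x = y.
Proof.
by move=> /(congr1 (fun z => z * i (uval u))); rewrite -!mulgA mor_uinvK !mulg1.
Qed.
Lemma conj_mulIl (u : units A) (x y : M) : i (uval u) * x = i (uval u) * y -> x = y.
Proof.
by move=> /(congr1 (fun z => i (uinv u) * z)); rewrite !mulgA mor_uinvK !mul1g.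
Qed.

Lemma conj_FAC (u : units A) (C : set M) :
  C \in FAC (range i) -> conj_set u C \in FAC (range i).
Proof.
move=> /set_mem[sA [C1 CM] [_ bI bS]]; apply: mem_set; split=> //.
  split; first by exists 1; rewrite // mulg1 mor_uvalV.
  move=> _ _ [c Cc <-] [d Cd <-]; exists (c * d); first exact: CM.
  by rewrite -!mulgA (mulgA (i (uinv u))) mor_uinvK mul1g.
split=> //.
  move=> [x c'] [y d'] /set_mem[/= [a _ ax] [c Cc cc']].
  move=> /set_mem[/= [b _ by_] [d Cd dd']].
  rewrite -{}ax -{}cc' -{}by_ -{}dd'.
  rewrite !mulgA -!gmulfM => /conj_mulIr eq_ac.
  have acA : (i (a * uval u), c) \in range i `*` C.
    by apply: mem_set; split=> //=; exists (a * uval u).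
  have bdA : (i (b * uval u), d) \in range i `*` C.
    by apply: mem_set; split=> //=; exists (b * uval u).
  have [eq_ab ->] := bI _ _ acA bdA eq_ac.
  by congr (_, _); move: eq_ab; rewrite !gmulfM =>
    /(congr1 (fun z => z * i (uinv u))); rewrite -!mulgA mor_uvalV !mulg1.
move=> m _; have [[_ c] /= [[a _ <-] Cc] acm] := bS (m * i (uval u)) I.
exists (i (a * uinv u), i (uval u) * c * i (uinv u)) => /=.
  by split=> /=; [exists (a * uinv u) | exists c].
rewrite gmulfM !mulgA -(mulgA (i a)) mor_uinvK mulg1 acm.
by rewrite -mulgA mor_uvalV mulg1.
Qed.

Definition FAC_act (u : units A) (C : FAC (range i)) : FAC (range i) :=
  exist _ (conj_set u (sval C)) (conj_FAC u (svalP C)).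

Lemma FAC_act1 C : FAC_act 1 C = C.
Proof.
apply: val_inj; rewrite /= /conj_set gmulf1.
by under eq_imagel do rewrite mul1g mulg1; rewrite image_id.
Qed.

Lemma FAC_actM u v C : FAC_act (u * v) C = FAC_act u (FAC_act v C).
Proof.
apply: val_inj; rewrite /= /conj_set image_comp.
apply: eq_imagel => c _ /=.
by rewrite !gmulfM !mulgA.
Qed.

Definition FAC_action : gaction (units A) (FAC (range i)) :=
  GAction FAC_act1 FAC_actM.
End FACAction.

(* [phi] is a phantom parameter: it selects the monoid structure on pairs. *)
Record sdprod (A B : monoidType) (phi : UMagmaMorphism.type B (End A)) :=
  SdProd { sdl : A; sdr : B }.

Section SemiDirect.
Variables (A B : monoidType) (phi : UMagmaMorphism.type B (End A)).

Definition star (b : B) (a : A) : A := (phi b : End A) a.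
Local Notation "b ⋆ a" := (star b a) (at level 35, right associativity).

Lemma star1l a : 1 ⋆ a = a.
Proof. by rewrite /star gmulf1. Qed.
Lemma starMl b1 b2 a : (b1 * b2) ⋆ a = b1 ⋆ (b2 ⋆ a).
Proof. by rewrite /star gmulfM. Qed.
Lemma star1r b : b ⋆ 1 = 1. Proof. exact: end1. Qed.
Lemma starMr b a1 a2 : b ⋆ (a1 * a2) = (b ⋆ a1) * (b ⋆ a2).
Proof. exact: endM. Qed.

Lemma ustar_proof b (u : units A) :
  (b ⋆ uval u) * (b ⋆ uinv u) = 1 /\ (b ⋆ uinv u) * (b ⋆ uval u) = 1.
Proof. by rewrite -!starMr uvalV uinvK star1r. Qed.
Definition ustar (b : B) (u : units A) : units A :=
  mkunit (ustar_proof b u).1 (ustar_proof b u).2.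

Lemma ustar1l u : ustar 1 u = u.
Proof. by apply: uval_inj; apply: star1l. Qed.
Lemma ustarMl b1 b2 u : ustar (b1 * b2) u = ustar b1 (ustar b2 u).
Proof. by apply: uval_inj; apply: starMl. Qed.
Lemma ustar1r b : ustar b 1 = 1.
Proof. by apply: uval_inj; apply: star1r. Qed.
Lemma ustarMr b u v : ustar b (u * v) = ustar b u * ustar b v.
Proof. by apply: uval_inj; apply: starMr. Qed.
Lemma ustarV b u : ustar b u^-1 = (ustar b u)^-1.
Proof. exact: uval_inj. Qed.

Definition Z1 : set (B -> units A) := [set chi |
  chi 1 = 1 /\ forall b1 b2, chi (b1 * b2) = chi b1 * ustar b1 (chi b2)].

Lemma Z1_one_proof : (fun=> 1) \in Z1.
Proof. by apply: mem_set; split=> // b1 b2; rewrite ustar1r mulg1. Qed.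
Definition Z1_one : Z1 := exist _ (fun=> 1) Z1_one_proof.

Lemma Z1_act_proof (u : units A) (chi : B -> units A) :
  chi \in Z1 -> (fun b => u * chi b * (ustar b u)^-1) \in Z1.
Proof.
move=> /set_mem[chi1 chiM]; apply: mem_set; split.
  by rewrite chi1 ustar1l mulg1 mulgV.
move=> b1 b2; rewrite chiM !ustarMr ustarV ustarMl.
by rewrite !mulgA mulgVK.
Qed.
Definition Z1_act (u : units A) (chi : Z1) : Z1 :=
  exist _ (fun b => u * sval chi b * (ustar b u)^-1)
    (Z1_act_proof u (svalP chi)).

Lemma Z1_act1 chi : Z1_act 1 chi = chi.
Proof.
apply: val_inj; apply: funext => b /=.
by rewrite ustar1r invg1 mul1g mulg1.
Qed.
Lemma Z1_actM u v chi : Z1_act (u * v) chi = Z1_act u (Z1_act v chi).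
Proof.
apply: val_inj; apply: funext => b /=.
by rewrite ustarMr invgM !mulgA.
Qed.
Definition Z1_action : gaction (units A) Z1 := GAction Z1_act1 Z1_actM.

Definition Z1_groupoid : groupoid := action_groupoid Z1_action.

Definition cohomologous : rel Z1 := fun chi chi' => `[< exists a0 : units A,
  forall b, sval chi b * ustar b a0 = a0 * sval chi' b >].

Lemma cohomologousP chi chi' :
  cohomologous chi chi' <-> exists u : units A, chi = Z1_act u chi'.
Proof.
split=> [/asboolP[u uP]|[u ->]].
  by exists u; apply: val_inj; apply: funext => b /=; rewrite -uP mulgK.
by apply/asboolP; exists u => b /=; rewrite mulgVK.
Qed.

Lemma cohomologous_refl : reflexive cohomologous.
Proof. by move=> chi; apply/cohomologousP; exists 1; rewrite Z1_act1. Qed.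
Lemma cohomologous_sym : symmetric cohomologous.
Proof.
by move=> x y; apply/idP/idP => /cohomologousP[u ->]; apply/cohomologousP;
  exists u^-1; rewrite -Z1_actM mulVg Z1_act1.
Qed.
Lemma cohomologous_trans : transitive cohomologous.
Proof.
move=> y x z /cohomologousP[u ->] /cohomologousP[v ->].
by apply/cohomologousP; exists (u * v); rewrite Z1_actM.
Qed.
Canonical cohomologous_equiv := EquivRel cohomologous
  cohomologous_refl cohomologous_sym cohomologous_trans.

Definition H1 := {eq_quot cohomologous}.
HB.instance Definition _ := Choice.on H1.
HB.instance Definition _ := EqQuotient.on H1.
HB.instance Definition _ := isPointed.Build H1 (\pi_H1 Z1_one).

Definition pair_of_sdprod (m : sdprod phi) := (sdl m, sdr m).
Definition sdprod_of_pair (p : A * B) : sdprod phi := SdProd phi p.1 p.2.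
Lemma pair_of_sdprodK : cancel pair_of_sdprod sdprod_of_pair.
Proof. by case. Qed.
HB.instance Definition _ := Choice.copy (sdprod phi) (can_type pair_of_sdprodK).

Definition sdone : sdprod phi := SdProd phi 1 1.
Definition sdmul (m n : sdprod phi) : sdprod phi :=
  SdProd phi (sdl m * (sdr m ⋆ sdl n)) (sdr m * sdr n).

Lemma sdmulA : associative sdmul.
Proof.
move=> [a1 b1] [a2 b2] [a3 b3]; congr SdProd; rewrite /= ?mulgA//.
by rewrite starMr starMl mulgA.
Qed.
Lemma sdmul1 : left_id sdone sdmul.
Proof. by move=> [a b]; congr SdProd; rewrite /= ?star1l mul1g. Qed.
Lemma sdmulr1 : right_id sdone sdmul.
Proof. by move=> [a b]; congr SdProd; rewrite /= ?star1r mulg1. Qed.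
HB.instance Definition _ := isMonoid.Build (sdprod phi) sdmulA sdmul1 sdmulr1.

Definition inA (a : A) : sdprod phi := SdProd phi a 1.
Definition inB (b : B) : sdprod phi := SdProd phi 1 b.

Lemma inA_morphism : monoid_morphism inA.
Proof.
by split=> // a1 a2; congr SdProd; rewrite /= ?star1l ?mulg1.
Qed.
HB.instance Definition _ := isUMagmaMorphism.Build A (sdprod phi) inA inA_morphism.
Lemma inB_morphism : monoid_morphism inB.
Proof.
by split=> // b1 b2; congr SdProd; rewrite /= ?star1r ?mulg1.
Qed.
HB.instance Definition _ := isUMagmaMorphism.Build B (sdprod phi) inB inB_morphism.

Definition FAC_groupoid : groupoid := action_groupoid (FAC_action inA).

Lemma range_inB_FAC : range inB \in FAC (range inA).
Proof.
apply: mem_set; split.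
- split; first by exists 1.
  by move=> _ _ [a _ <-] [b _ <-]; exists (a * b); rewrite // gmulfM.
- split; first by exists 1.
  by move=> _ _ [a _ <-] [b _ <-]; exists (a * b); rewrite // gmulfM.
split=> //.
  move=> [x y] [x' y'] /set_mem[/= [a _ ax] [b _ yb]].
  move=> /set_mem[/= [c _ cx] [d _ dy]].
  rewrite -{}ax -{}yb -{}cx -{}dy => -[].
  by rewrite !star1l !mulg1 !mul1g => -> ->.
move=> [a b] _; exists (inA a, inB b); first by split; [exists a|exists b].
by congr SdProd; rewrite /= ?star1l ?mulg1 ?mul1g.
Qed.
Definition FAC_B : FAC (range inA) := exist _ (range inB) range_inB_FAC.

Definition pi0_FAC := pi0 FAC_groupoid.
HB.instance Definition _ := Choice.on pi0_FAC.
HB.instance Definition _ := EqQuotient.on pi0_FAC.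
HB.instance Definition _ := isPointed.Build pi0_FAC (\pi_pi0_FAC FAC_B).

Definition Ker (f : sdprod phi -> A) : set (sdprod phi) := f @^-1` [set 1].

Definition cobar (chi : Z1) (m : sdprod phi) : A :=
  sdl m * uval (sval chi (sdr m))^-1.
End SemiDirect.

(* Main.v *)
(* The kernel of [cobar chi] is the graph [{chi(b) b}] of [chi]: the cocycle
   identity says that this graph is a submonoid, and invertibility of the values
   makes it a complement of [A].  Conversely, let [(A, C)] be a factorization and
   write [b = a c] with [c = x b] in [C], so that [a x = 1].  For any [x' b] in
   [C], the two factorizations [1 (x' b) = (x' a) c] of the same element give
   [x' a = 1] and [x' b = c]; hence [C] is the graph of a map into [U(A)].
   Conjugating the graph of [chi] by [u] yields the graph of [u . chi], so the
   bijection is equivariant and therefore an isomorphism of action groupoids. *)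

Require Import Defs.
From HB Require Import structures.
From mathcomp Require Import all_boot.
From mathcomp Require Import boolp classical_sets functions.

Set Implicit Arguments.
Unset Strict Implicit.
Unset Printing Implicit Defensive.

Local Open Scope classical_set_scope.
Local Open Scope group_scope.

(** An arrow of an action groupoid is a group element with a proof of a boolean equality, so
    elements alone can be compared, without transport along the equality of object maps. *)
Lemma action_functor_eq (K : groupoid) (G : groupType) (Y : choiceType)
    (a : gaction G Y) (F F' : functor K (action_groupoid a)) :
  (forall x, F x = F' x) ->
  (forall x y (f : hom x y), ahom_elt (fhom F f) = ahom_elt (fhom F' f)) ->
  F = F'.
Proof.
case: F F' => [F Fh F1 FM] [F' Fh' F1' FM'] /= eqF.
have {}eqF : F = F' by apply: funext.
case: _ / eqF in Fh' F1' FM' *.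
move=> eqh; have {}eqh : Fh = Fh'.
  apply: functional_extensionality_dep => x.
  apply: functional_extensionality_dep => y.
  apply: functional_extensionality_dep => f.
  by apply: val_inj; exact: eqh.
case: _ / eqh in F1' FM' *.
by rewrite (Prop_irrelevance F1 F1') (Prop_irrelevance FM FM').
Qed.

Section Equivariant.
Variables (G : groupType) (X Y : choiceType).
Variables (a : gaction G X) (b : gaction G Y) (f : X -> Y).
Hypothesis fE : forall g x, f (a g x) = b g (f x).

Lemma equivariant_hom_subproof x y (h : ahom a x y) : b (sval h) (f x) == f y.
Proof. by rewrite -fE (eqP (svalP h)). Qed.

Definition equivariant_hom x y (h : ahom a x y) : ahom b (f x) (f y) :=
  exist _ (sval h) (equivariant_hom_subproof h).

Lemma equivariant_hom1 x : equivariant_hom (ahom1 a x) = ahom1 b (f x).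
Proof. exact: val_inj. Qed.

Lemma equivariant_homM x y z (h : ahom a y z) (k : ahom a x y) :
  equivariant_hom (ahomM h k) = ahomM (equivariant_hom h) (equivariant_hom k).
Proof. exact: val_inj. Qed.

Definition equivariant_functor :
    functor (action_groupoid a) (action_groupoid b) :=
  @Functor (action_groupoid a) (action_groupoid b)
    f equivariant_hom equivariant_hom1 equivariant_homM.

End Equivariant.

(** The inverse of an equivariant bijection is again equivariant, and the functors of both maps
    leave the group element of each arrow unchanged. *)
Lemma equivariant_functor_iso (G : groupType) (X Y : choiceType)
    (a : gaction G X) (b : gaction G Y) (f : X -> Y)
    (fE : forall g x, f (a g x) = b g (f x)) :
  bijective f -> groupoid_iso (equivariant_functor fE).
Proof.
case=> g fK gK.
have gE u y : g (b u y) = a u (g y) by rewrite -{1}(gK y) -fE fK.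
by exists (equivariant_functor gE); split; apply: action_functor_eq.
Qed.

Lemma isomorphic_action (G : groupType) (X : choiceType) (a : gaction G X)
    (x y : action_groupoid a) :
  isomorphic x y <-> exists g, a g x = y.
Proof.
split=> [/asboolP[[g /eqP gxy]]|[g gxy]]; first by exists g.
by apply/asboolP; constructor; exists g; apply/eqP.
Qed.

Section CocycleFactorization.
Variables (A B : monoidType) (phi : UMagmaMorphism.type B (End A)).
Implicit Types (chi : Z1 phi) (b : B).

Lemma Ker_cobarE chi m : Ker (cobar chi) m <-> sdl m = uval (sval chi (sdr m)).
Proof.
rewrite /Ker /cobar /= uval_inv; split=> [e|->]; last exact: uvalV.
by rewrite -[sdl m]mulg1 -(uinvK (sval chi (sdr m))) mulgA e mul1g.
Qed.

Lemma Ker_cobar_graph chi b :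
  Ker (cobar chi) (SdProd phi (uval (sval chi b)) b).
Proof. exact/Ker_cobarE. Qed.

Lemma Ker_cobar_FAC chi : Ker (cobar chi) \in FAC (range (@inA A B phi)).
Proof.
have /set_mem[chi1 chiM] := svalP chi.
apply: mem_set; split.
- split; first by exists 1.
  by move=> _ _ [a _ <-] [b _ <-]; exists (a * b); rewrite // gmulfM.
- split; first by apply/Ker_cobarE; rewrite /= chi1.
  move=> x y /Ker_cobarE ex /Ker_cobarE ey; apply/Ker_cobarE.
  by rewrite /= ex ey chiM.
split=> //.
  move=> [y [x b]] [y' [x' b']] /set_mem[/= [a _ <-] /Ker_cobarE/= ->].
  move=> /set_mem[/= [a' _ <-] /Ker_cobarE/= ->] [].
  rewrite !star1l !mul1g => eqa eqb; rewrite -{}eqb in eqa *.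
  congr (inA phi _, _).
  move: eqa => /(congr1 (fun z => z * uinv (sval chi b))).
  by rewrite -!mulgA uvalV !mulg1.
move=> [a b] _.
(* The factorization is [ab = (a chi(b)^-1)(chi(b) b)]. *)
exists (inA phi (a * uinv (sval chi b)), SdProd phi (uval (sval chi b)) b) => /=.
  by split; [exists (a * uinv (sval chi b)) | apply: Ker_cobar_graph].
by congr SdProd; rewrite /= ?mul1g // star1l -mulgA uinvK mulg1.
Qed.

Definition FAC_of_Z1 chi : FAC (range (@inA A B phi)) :=
  exist _ (Ker (cobar chi)) (Ker_cobar_FAC chi).

Lemma FAC_of_Z1_act (u : units A) chi :
  FAC_of_Z1 (Z1_action phi u chi) = FAC_action (@inA A B phi) u (FAC_of_Z1 chi).
Proof.
(* Moving [u^-1] to the left of [b] turns it into [b ⋆ u^-1], the inverse of [ustar b u] that occurs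
   in the action on cocycles. *)
have conjE x b : inA phi (uval u) * SdProd phi x b * inA phi (uinv u) =
    SdProd phi (uval u * x * star phi b (uinv u)) b.
  by congr SdProd; rewrite /= ?star1l ?mul1g ?mulg1.
apply: val_inj; apply/seteqP; split=> [[x b] /Ker_cobarE /= -> | _ [[x b] /= + <-]].
  exists (SdProd phi (uval (sval chi b)) b); last exact: conjE.
  exact: Ker_cobar_graph.
by move=> /Ker_cobarE /= ->; apply/Ker_cobarE; rewrite conjE.
Qed.

Lemma FAC_of_Z1_one : FAC_of_Z1 (Z1_one phi) = FAC_B phi.
Proof.
apply: val_inj; apply/seteqP; split=> [[x b] /Ker_cobarE /= -> | _ [b _ <-]].
  by exists b.
exact/Ker_cobarE.
Qed.

Lemma FAC_of_Z1_inj : injective FAC_of_Z1.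
Proof.
move=> chi chi' /(congr1 sval) /= eqK; apply: val_inj; apply: funext => b.
have := Ker_cobar_graph chi b; rewrite eqK => /Ker_cobarE /= eqb.
exact: uval_inj.
Qed.

Lemma factorization_graph (C : set (sdprod phi)) b :
    factorization (range (@inA A B phi)) C ->
  exists u : units A, forall x, C (SdProd phi x b) <-> x = uval u.
Proof.
move=> [_ _ [_ injC surjC]].
have [[_ [x b']] [/= [a _ <-] Cx] [+ +]] := surjC (inB phi b) I.
rewrite star1l mul1g => ax eqb; rewrite {}eqb in Cx.
have uniq x' : C (SdProd phi x' b) -> x' * a = 1 /\ x' = x.
  move=> Cx'.
  have xaC : (inA phi (x' * a), SdProd phi x b) \in range (inA phi) `*` C.
    by apply: mem_set; split=> //=; exists (x' * a).
  have oneC : (inA phi 1, SdProd phi x' b) \in range (inA phi) `*` C.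
    by apply: mem_set; split=> //=; exists 1.
  suff /(injC _ _ xaC oneC)[-> ->] :
    inA phi (x' * a) * SdProd phi x b = inA phi 1 * SdProd phi x' b by [].
  by congr SdProd; rewrite /= !star1l -mulgA ax mulg1 mul1g.
(* Applied to [x] itself, [uniq] supplies [x * a = 1]; with [ax] this makes [a] a two-sided inverse
   of [x]. *)
have [xa _] := uniq _ Cx.
by exists (mkunit xa ax) => x'; split=> [/uniq[]|->].
Qed.

Lemma FAC_of_Z1_surj (C : FAC (range (@inA A B phi))) :
  exists chi, FAC_of_Z1 chi = C.
Proof.
case: C => C facC; have /set_mem fC := facC.
have [chi chiE] := choice (fun b => factorization_graph b fC).
have chiZ : chi \in Z1 phi.
  have [_ [C1 CM] _] := fC.
  (* Through [chiE], the two cocycle conditions say that [C] contains the identity and the product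
     of the graph points over [b1] and [b2]. *)
  apply: mem_set; split=> [|b1 b2]; apply: uval_inj; symmetry.
    exact/chiE.
  have Cchi b : C (SdProd phi (uval (chi b)) b) by apply/chiE.
  exact/chiE/(CM _ _ (Cchi b1) (Cchi b2)).
exists (exist _ chi chiZ); apply: val_inj; apply/seteqP.
split=> [[x b] /Ker_cobarE/chiE //|[x b] /chiE xE].
exact/Ker_cobarE.
Qed.

Lemma FAC_of_Z1_bij : bijective FAC_of_Z1.
Proof.
have [g gK] := choice FAC_of_Z1_surj.
by exists g => // chi; apply: FAC_of_Z1_inj; rewrite gK.
Qed.

Lemma cohomologous_FAC chi chi' :
  cohomologous chi chi' =
  isomorphic (FAC_of_Z1 chi : FAC_groupoid phi) (FAC_of_Z1 chi').
Proof.
(* [cohomologousP] expresses the first cocycle as a translate of the second, whereas an arrow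
   translates its source to its target; symmetry aligns the two. *)
rewrite cohomologous_sym; apply/idP/idP => [/cohomologousP[u ->]|].
  by apply/isomorphic_action; exists u; rewrite -FAC_of_Z1_act.
move=> /isomorphic_action[u]; rewrite -FAC_of_Z1_act => /FAC_of_Z1_inj <-.
by apply/cohomologousP; exists u.
Qed.

(** From left to right this makes the map on classes well defined; from right to left it makes that
    map injective. *)
Lemma eq_H1_pi0 chi chi' :
  (\pi_(H1 phi) chi = \pi_(H1 phi) chi')%qT <-> 
  (\pi_(pi0_FAC phi) (FAC_of_Z1 chi) = \pi_(pi0_FAC phi) (FAC_of_Z1 chi'))%qT.
Proof.
split=> [/(@eqmodP _ (cohomologous_equiv phi))|].
  move=> /= h; apply/(@eqmodP _ (isomorphic_equiv (FAC_groupoid phi))).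
  by rewrite /= -cohomologous_FAC.
move=> /(@eqmodP _ (isomorphic_equiv (FAC_groupoid phi))) /= h.
by apply/(@eqmodP _ (cohomologous_equiv phi)); rewrite /= cohomologous_FAC.
Qed.

End CocycleFactorization.

Theorem theorem3p9 (A B : monoidType) (phi : UMagmaMorphism.type B (End A)) :
  exists F : functor (Z1_groupoid phi) (FAC_groupoid phi),
    [/\ forall chi : Z1 phi, sval (F chi) = Ker (cobar chi),
        forall (chi chi' : Z1_groupoid phi) (f : hom chi chi'),
          ahom_elt (fhom F f) = ahom_elt f,
        groupoid_iso F &
        exists f : H1 phi -> pi0_FAC phi,
          (forall chi : Z1 phi,
             f (\pi_(H1 phi) chi)%qT = (\pi_(pi0_FAC phi) (F chi))%qT) /\
          pointed_iso f].
Proof.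
exists (equivariant_functor (@FAC_of_Z1_act A B phi)); split=> //.
  exact/equivariant_functor_iso/FAC_of_Z1_bij.
pose f (x : H1 phi) : pi0_FAC phi := (\pi_(pi0_FAC phi) (FAC_of_Z1 (repr x)))%qT.
have fE chi : f (\pi_(H1 phi) chi)%qT = (\pi_(pi0_FAC phi) (FAC_of_Z1 chi))%qT.
  by apply/eq_H1_pi0; rewrite reprK.
exists f; split=> //; split; last first.
  by rewrite [LHS]fE FAC_of_Z1_one.
(* The inverse on classes applies [g] to a representative. *)
have [g gK Kg] := FAC_of_Z1_bij phi.
exists (fun y => \pi_(H1 phi) (g (repr y)))%qT => [x|y]; last first.
  by rewrite fE Kg reprK.
by rewrite -[RHS]reprK; apply/eq_H1_pi0; rewrite Kg reprK.
Qed.
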